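(* Let $0\le\alpha\le1$ and let all channel realizations in the finite set $\mathcal H$ be equally likely. The average delay when time-sharing, with probability $\alpha$ of using the first-to-complete scheme (with alignment sets of sizes $2$ and $4$) and probability $1-\alpha$ of aligning using only complements, is $$d(\alpha)=(1-\alpha)\,d^{(2)}+\alpha\, d^{(2,4)}=\Big(1-\frac{\alpha}{4}\Big)|\mathcal H|,$$ where $d^{(2)}$ is the average delay of alignment using only complements and $d^{(2,4)}$ is the average delay of the first-to-complete scheme.
   Context: $\mathcal H$ is a finite set of complex $K\times K$ matrices (quantized channel realizations $\mathbf H=[h_{kl}]$). At each time step a channel realization $\mathbf H(t)\in\mathcal H$ occurs, uniformly distributed on $\mathcal H$ and independent over time. The complement $\mathbf H^c$ of $\mathbf H$ has entries $h_{kk}$ on the diagonal and $-h_{kl}$ for $k\ne l$. An alignment set of size $m$ ($m$ a positive even integer) is a collection of $m$ matrices $\mathbf H^{(0)},\ldots,\mathbf H^{(m-1)}$ such that $h^{(0)}_{kk}=\cdots=h^{(m-1)}_{kk}$ for all $k$, and for all $k\ne l$: $|h^{(0)}_{kl}|=\cdots=|h^{(m-1)}_{kl}|$, exactly $\frac m2-1$ of the indices $i\in\{1,\ldots,m-1\}$ satisfy $h^{(i)}_{kl}=h^{(0)}_{kl}$, and exactly $\frac m2$ satisfy $h^{(i)}_{kl}=-h^{(0)}_{kl}$. Thus $\{\mathbf H,\mathbf H^c\}$ is an alignment set of size $2$. $\mathcal A_{\mathbf H}$ denotes an alignment set of size $4$ having $\mathbf H$ as a member; its four members are distinct elements of $\mathcal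 H$, and it does not contain $\mathbf H^c\in\mathcal H$. Alignment using complements: a symbol first sent at time $t_0$, when the realization is $\mathbf H$, is recovered at the first time $t>t_0$ at which $\mathbf H^c$ occurs. First-to-complete scheme: a symbol first sent at time $t_0$, when the realization is $\mathbf H$, is recovered at the first time $t>t_0$ by which either $\mathbf H^c$ has occurred or all three other members of $\mathcal A_{\mathbf H}$ have occurred (occurrences being counted at times after $t_0$). Time-sharing scheme: for the realization $\mathbf H$ at $t_0$, independently of the channel, with probability $1-\alpha$ use alignment using complements and with probability $\alpha$ use the first-to-complete scheme. The average delay of a scheme is the expected number of time steps between the first time a symbol is sent and the time it is recovered at the receiver (recovery at time $t_1$ gives delay $t_1-t_0$). *)

(* Defs.v *)
From HB Require Import structures.
From mathcomp Require Import all_boot all_order all_algebra finmap.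
From mathcomp Require Import complex.
From mathcomp Require Import all_classical all_reals all_analysis.

Set Implicit Arguments.
Unset Strict Implicit.
Unset Printing Implicit Defensive.

Import Order.TTheory GRing.Theory Num.Theory.
Local Open Scope classical_set_scope.
Local Open Scope ring_scope.
Local Open Scope complex_scope.

Definition complement (R : realType) (K : nat) (H : 'M[R[i]]_K) : 'M[R[i]]_K :=
  \matrix_(k, l) (if k == l then H k l else - H k l).

(* The size is m = n.+1, so that the members are indexed by 0, ..., m - 1.
   Both counts being exact, an off-diagonal entry of a member cannot be 0. *)
Definition alignment_set (R : realType) (K n : nat)
    (A : 'I_n.+1 -> 'M[R[i]]_K) : Prop :=
  [/\ ~~ odd n.+1,
      forall k i, A i k k = A ord0 k k
    & forall k l, k != l ->
      [/\ forall i, `|A i k l| = `|A ord0 k l|,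
          #|[set i : 'I_n.+1 | (i != ord0) && (A i k l == A ord0 k l)]%SET|
            = (n.+1./2 - 1)%N
        & #|[set i : 'I_n.+1 | (i != ord0) && (A i k l == - A ord0 k l)]%SET|
            = n.+1./2]].

(* S carries the discrete sigma-algebra: only meant for families X whose
   values range over a finite set and whose fibers are measurable. *)
Definition mutually_independent d (T : measurableType d) (R : realType)
    (P : probability T R) (S : Type) (X : nat -> T -> S) : Prop :=
  forall (J : {fset nat}) (B : nat -> set S),
    P (\bigcap_(t in [set` J]) (X t @^-1` B t)) =
    (\prod_(t <- J) P (X t @^-1` B t))%E.

Definition iid_uniform d (T : measurableType d) (R : realType)
    (P : probability T R) (S : choiceType) (HH : {fset S})
    (X : nat -> T -> S) : Prop :=
  [/\ forall t w, X t w \in HH,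
      forall t s, measurable (X t @^-1` [set s]),
      forall t s, s \in HH -> P (X t @^-1` [set s]) = ((#|` HH|%:R)^-1)%:E
    & mutually_independent P X].

Definition independent_coin d (T : measurableType d) (R : realType)
    (P : probability T R) (S : Type) (X : nat -> T -> S) (alpha : R)
    (C : T -> bool) : Prop :=
  [/\ measurable (C @^-1` [set true]),
      P (C @^-1` [set true]) = alpha%:E
    & forall (b : bool) (J : {fset nat}) (B : nat -> set S),
        P (C @^-1` [set b] `&` \bigcap_(t in [set` J]) (X t @^-1` B t)) =
        (P (C @^-1` [set b]) * P (\bigcap_(t in [set` J]) (X t @^-1` B t)))%E].

Section Schemes.
Variables (R : realType) (K : nat).
Implicit Types (h : nat -> 'M[R[i]]_K) (A : 'M[R[i]]_K -> 'I_4 -> 'M[R[i]]_K).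

Definition occurred h (t0 t : nat) (M : 'M[R[i]]_K) : Prop :=
  exists s : nat, [/\ (t0 < s)%N, (s <= t)%N & h s = M].

Definition recovered_complement h (t0 t : nat) : Prop :=
  h t = complement (h t0).

Definition recovered_first_to_complete A h (t0 t : nat) : Prop :=
  occurred h t0 t (complement (h t0)) \/
  forall i : 'I_4, A (h t0) i <> h t0 -> occurred h t0 t (A (h t0) i).

(* t1 - t0 for the first t1 > t0 satisfying the recovery condition,
   and +oo when there is no such t1 (infimum of the empty set). *)
Definition delay (recovered : nat -> Prop) (t0 : nat) : \bar R :=
  ereal_inf [set ((t - t0)%N%:R)%:E | t in [set t | (t0 < t)%N /\ recovered t]].

Definition complement_delay h (t0 : nat) : \bar R :=
  delay (recovered_complement h t0) t0.

Definition first_to_complete_delay A h (t0 : nat) : \bar R :=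
  delay (recovered_first_to_complete A h t0) t0.

Definition time_sharing_delay A (c : bool) h (t0 : nat) : \bar R :=
  if c then first_to_complete_delay A h t0 else complement_delay h t0.

End Schemes.

(* The library's expectation takes real-valued functions only, whereas a delay
   may be +oo. *)
Definition average_delay d (T : measurableType d) (R : realType)
    (P : probability T R) (D : T -> \bar R) : \bar R :=
  (\int[P]_w D w)%E.

(* Main.v *)
(** The mean delay is the sum over [n] of the probabilities that the symbol is
    still unrecovered at time [t0 + n].  With [N] the number of realizations,
    [n] consecutive draws avoid a given set of [k] realizations with
    probability [(1 - k/N)^n].  Complement alignment fails for [n] steps iff
    they avoid [H^c]; the first-to-complete scheme fails iff they avoid both
    [H^c] and one of the three other members of [A_H], so inclusion-exclusion
    gives [3 (1 - 2/N)^n - 3 (1 - 3/N)^n + (1 - 4/N)^n].  Summing the geometric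
    series yields [N] and [3N/2 - N + N/4 = 3N/4]. *)
Require Import Defs.
From HB Require Import structures.
From mathcomp Require Import all_boot all_order all_algebra finmap.
From mathcomp Require Import complex.
From mathcomp Require Import all_classical all_reals all_analysis.
From mathcomp Require Import measurable_realfun zify ring lra.

Set Implicit Arguments.
Unset Strict Implicit.
Unset Printing Implicit Defensive.

Import Order.TTheory GRing.Theory Num.Theory.
Local Open Scope classical_set_scope.
Local Open Scope ring_scope.
Local Open Scope complex_scope.

(** * Probabilities of avoiding a set of realizations *)

Section Independence.
Context d (T : measurableType d) (R : realType) (P : probability T R).
Context (S : choiceType) (HH : {fset S}) (X : nat -> T -> S).
Hypothesis Xiid : iid_uniform P HH X.

(** The sample space has mass 1, hence a point, and its image lies in [HH]. This makes the
    cardinality of [HH] invertible. *)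
Lemma support_nonempty : exists H, H \in HH.
Proof.
have [XH _ _ _] := Xiid.
have [w _] : [set: T] !=set0.
  apply/set0P/eqP => T0; have := @probability_setT _ _ _ P.
  by rewrite T0 measure0 => /eqP; rewrite eqe eq_sym oner_eq0.
by exists (X 0 w).
Qed.

(** [X t] takes finitely many values, so the preimage of an arbitrary [B] is a finite union of
    measurable singleton fibers. *)
Lemma measurable_fiber t (B : set S) : measurable (X t @^-1` B).
Proof.
have [XH mX _ _] := Xiid.
rewrite (_ : _ @^-1` _ = \bigcup_(x in [set` HH] `&` B) X t @^-1` [set x]).
  by apply: fin_bigcup_measurable => //; exact: finite_setIl.
apply/seteqP; split => [w Bw|w [x [_ Bx]] /= -> //].
exists (X t w) => //; split => //=; exact: XH.
Qed.

Lemma total_probability t (E : set T) (s : seq S) : measurable E -> uniq s ->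
  P (E `&` X t @^-1` [set` s]) =
  (\sum_(x <- s) P (E `&` X t @^-1` [set x]))%E.
Proof.
move=> mE; elim: s => [_|x s IHs /= /andP[xs us]].
  by rewrite big_nil set_nil preimage_set0 setI0 measure0.
rewrite big_cons -IHs // -measureU.
- rewrite -setIUr -preimage_setU; congr (P (_ `&` _ @^-1` _)).
  by apply/seteqP; split => y /=; rewrite inE => /predU1P.
- exact: measurableI (measurable_fiber _ _).
- exact: measurableI (measurable_fiber _ _).
apply/seteqP; split => // w [[_ /= ->] [_ /=]].
by rewrite (negbTE xs).
Qed.

Definition avoids t0 n (s : seq S) : set T :=
  [set w | forall t, (t0 < t <= t0 + n)%N -> X t w \notin s].

Lemma measurable_avoids t0 n s : measurable (avoids t0 n s).
Proof.
rewrite (_ : avoids _ _ _ =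
  \bigcap_(t in [set t | (t0 < t <= t0 + n)%N]) X t @^-1` [set x | x \notin s]).
  by apply: bigcap_measurableType => t _; exact: measurable_fiber.
by apply/seteqP; split.
Qed.

Lemma avoids_cat t0 n s1 s2 :
  avoids t0 n s1 `&` avoids t0 n s2 = avoids t0 n (s1 ++ s2).
Proof.
apply/seteqP; split => [w [h1 h2] t tn|w h].
  by rewrite mem_cat negb_or h1 ?h2.
by split=> t /h; rewrite mem_cat negb_or => /andP[].
Qed.

Lemma eq_avoids t0 n s1 s2 : s1 =i s2 -> avoids t0 n s1 = avoids t0 n s2.
Proof.
by move=> eq_s; apply/seteqP; split => w h t /h; rewrite eq_s.
Qed.

Local Notation N := (#|` HH|%:R : R).

Lemma prob_notin t (s : seq S) : uniq s -> {subset s <= HH} ->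
  P (X t @^-1` [set x | x \notin s]) = (1 - (size s)%:R / N)%:E.
Proof.
move=> us sH; have [_ _ PX _] := Xiid.
rewrite (_ : _ @^-1` _ = ~` (X t @^-1` [set` s])); last first.
  by apply/seteqP; split => w /= /negP.
rewrite probability_setC; last exact: measurable_fiber.
rewrite -[X t @^-1` _]setTI total_probability //.
under eq_big_seq => x xs do rewrite setTI PX ?sH //.
rewrite sumEFin big_const_seq count_predT iter_addr addr0.
by rewrite -EFinB mulr_natl.
Qed.

Variables (alpha : R) (C : T -> bool).
Hypothesis Ccoin : independent_coin P X alpha C.

Lemma measurable_coin b : measurable (C @^-1` [set b]).
Proof.
have [mC _ _] := Ccoin; case: b => //.
rewrite (_ : C @^-1` _ = ~` (C @^-1` [set true])); first exact: measurableC.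
by apply/seteqP; split => w /=; case: (C w).
Qed.

Lemma prob_coin b : P (C @^-1` [set b]) = (if b then alpha else 1 - alpha)%:E.
Proof.
have [mC PC _] := Ccoin; case: b => //.
rewrite (_ : C @^-1` _ = ~` (C @^-1` [set true])).
  by rewrite probability_setC // PC EFinB.
by apply/seteqP; split => w /=; case: (C w).
Qed.

(** The coin, the draw at [t0] and the [n] later draws are jointly independent, so the probability
    factors. The start [H] is fixed because the realizations to be avoided will depend on it. *)
Lemma prob_start_avoids b H t0 n (s : seq S) : H \in HH ->
  uniq s -> {subset s <= HH} ->
  P (C @^-1` [set b] `&` (X t0 @^-1` [set H] `&` avoids t0 n s)) =
  ((if b then alpha else 1 - alpha) *
    (N^-1 * (1 - (size s)%:R / N) ^+ n))%:E.
Proof.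
move=> HHH us sH; have [_ _ PX Xindep] := Xiid; have [_ _ Cindep] := Ccoin.
(* A single family of constraints covers start and avoidance: [[set H]] at [t0], the complement of
   [s] at all other times. *)
pose J := [fset t in t0 :: iota t0.+1 n]%fset.
pose B t := if t == t0 then [set H] else [set x | x \notin s].
rewrite (_ : _ `&` avoids _ _ _ = \bigcap_(t in [set` J]) (X t @^-1` B t)).
  rewrite Cindep Xindep prob_coin EFinM; congr (_ * _)%E.
  rewrite (perm_big (t0 :: iota t0.+1 n)); last first.
    apply: uniq_perm; rewrite ?fset_uniq //=.
      by rewrite iota_uniq mem_iota ltnn.
    by move=> t; rewrite !inE.
  rewrite big_cons {1}/B eqxx PX // EFinM; congr (_ * _)%E.
  rewrite big_seq (eq_bigr (fun=> (1 - (size s)%:R / N)%:E)); last first.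
    move=> t; rewrite mem_iota => /andP[t0t _].
    by rewrite /B gtn_eqF // prob_notin.
  (* The first time of the range is generalized, since each induction step peels it off. *)
  rewrite -big_seq; elim: n (t0.+1) {J} => [t|n IHn t].
    by rewrite big_nil expr0.
  by rewrite big_cons IHn exprS EFinM.
apply/seteqP; split => [w [/= X0 h] t|w h].
  rewrite /= !inE mem_iota /B => /orP[/eqP ->|tn]; first by rewrite eqxx.
  by rewrite gtn_eqF /=; [apply: h; lia|lia].
split => [|t tn].
  by have /= := h t0; rewrite /B !inE !eqxx; exact.
have /= := h t; rewrite !inE mem_iota /B gtn_eqF; last by lia.
by apply; apply/orP; right; lia.
Qed.

End Independence.

(** * Delay as a sum of tail probabilities *)

Definition unrecovered (rec : nat -> Prop) (t0 n : nat) : Prop :=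
  forall t, (t0 < t <= t0 + n)%N -> ~ rec t.

(** [unrecovered] at [n] means that the delay exceeds [n], and a natural number is the count of the
    naturals below it. If recovery never happens, every term is 1 and both sides are infinite. *)
Lemma delay_tail_sum (R : realType) (rec : nat -> Prop) (t0 : nat) :
  delay R rec t0 = (\sum_(n <oo) (`[< unrecovered rec t0 n >]%:R)%:E)%E.
Proof.
have [[t rect]|norec] := pselect (exists t, (t0 < t)%N /\ rec t); last first.
  rewrite /delay [X in ereal_inf X](_ : _ = set0); last first.
    by apply/seteqP; split => // x [t rect]; case: norec; exists t.
  rewrite ereal_inf0 (eq_eseriesr (g := fun=> 1%E)); last first.
    move=> n _; rewrite asboolT // => t /andP[t0t _] rect.
    by apply: norec; exists t.
  apply/esym/cvg_lim => //=.
  rewrite [X in X @ _ --> _](_ : _ = EFin \o (fun n => n%:R)); last first.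
    by apply/funext => n; rewrite sumEFin sumr_const_nat subn0.
  apply/cvgeryP; exact: cvgr_idn.
pose Q t := `[< (t0 < t)%N /\ rec t >].
have exQ : exists t, Q t by exists t; exact/asboolP.
case: (ex_minnP exQ) => t1 /asboolP[t01 rec1] min1.
have unrecE n : `[< unrecovered rec t0 n >] = (n < t1 - t0)%N.
  apply/asboolP/idP => [h|nt s /andP[t0s sn] recs].
    by rewrite ltnNge; apply/negP => le_n; apply: (h t1) rec1; lia.
  have : (t1 <= s)%N by apply: min1; exact/asboolP.
  lia.
rewrite (nneseries_split 0 (t1 - t0)); last by move=> k _; rewrite lee_fin.
rewrite [X in (_ + X)%E]eseries0 => [|n /= le_n _]; last first.
  by rewrite unrecE ltnNge -[(_ - _)%N]add0n le_n.
rewrite adde0 big_nat (eq_bigr (fun=> 1%E)); last first.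
  by move=> n /= lt_n; rewrite unrecE lt_n.
rewrite -big_nat sumEFin sumr_const_nat subn0.
apply/eqP; rewrite eq_le; apply/andP; split.
  by apply: ereal_inf_lbound; exists t1.
apply/ereal_infP => _ [t' [t0t' rect'] <-].
rewrite lee_fin ler_nat; apply: leq_sub2r.
by apply: min1; exact/asboolP.
Qed.

(** The terms are nonnegative, so sum and integral can be exchanged, even if the average is
    infinite. *)
Lemma average_delay_tail_sum d (T : measurableType d) (R : realType)
    (P : probability T R) (rec : T -> nat -> Prop) (t0 : nat) :
  (forall n, measurable [set w | unrecovered (rec w) t0 n]) ->
  average_delay P (fun w => delay R (rec w) t0) =
  (\sum_(n <oo) P [set w | unrecovered (rec w) t0 n])%E.
Proof.
move=> mU; rewrite /average_delay.
under eq_integral do rewrite delay_tail_sum.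
have tailE n : (fun w => (`[< unrecovered (rec w) t0 n >]%:R)%:E) =
    EFin \o (\1_[set w | unrecovered (rec w) t0 n] : T -> R).
  by apply/funext => w; rewrite /= indicE.
rewrite integral_nneseries //; last first.
  by move=> n; rewrite tailE; apply/measurable_EFinP; exact: measurable_indic.
apply: eq_eseriesr => n _; rewrite tailE integral_indic //.
by rewrite setIT.
Qed.

(** Four ratios are provided for because those that occur are [1 - k / N] with [k] from 1 to 4. *)
Lemma geometric_nneseries (R : realType) (c1 x1 c2 x2 c3 x3 c4 x4 : R) :
  `|x1| < 1 -> `|x2| < 1 -> `|x3| < 1 -> `|x4| < 1 ->
  (\sum_(n <oo)
    (c1 * x1 ^+ n + c2 * x2 ^+ n + c3 * x3 ^+ n + c4 * x4 ^+ n)%:E)%E =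
  (c1 / (1 - x1) + c2 / (1 - x2) + c3 / (1 - x3) + c4 / (1 - x4))%:E.
Proof.
move=> h1 h2 h3 h4; apply/cvg_lim => //.
rewrite [X in X @ _ --> _](_ : _ = EFin \o (series (geometric c1 x1) \+
    series (geometric c2 x2) \+ series (geometric c3 x3) \+
    series (geometric c4 x4))); last first.
  by apply/funext => n; rewrite sumEFin !big_split.
apply: cvg_EFin; first exact: nearW.
by do 3 ?apply: cvgD; exact: cvg_geometric_series.
Qed.

(** Inclusion-exclusion for two events with real values, so that the later algebra takes place in
    [R]. *)
Lemma prob_setU d (T : measurableType d) (R : realType) (P : probability T R)
    (A B : set T) (a b c : R) : measurable A -> measurable B ->
  P A = a%:E -> P B = b%:E -> P (A `&` B) = c%:E ->
  P (A `|` B) = (a + b - c)%:E.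
Proof.
move=> mA mB PA PB PAB.
have Afin : (P A < +oo)%E by rewrite PA ltry.
by rewrite [LHS](measureUfinl mA mB Afin) EFinB EFinD -PA -PB -PAB.
Qed.

(** * Recovery conditions and failure of the first-to-complete scheme *)

Definition recovered_time_sharing (R : realType) (K : nat)
    (A : 'M[R[i]]_K -> 'I_4 -> 'M[R[i]]_K) (c : bool) h t0 : nat -> Prop :=
  if c then recovered_first_to_complete A h t0 else recovered_complement h t0.

(** Occurrences only accumulate, so failure throughout the window is decided at its last time: the
    complement and at least one other member are still missing there. [lift i0] enumerates the three
    members other than the starting one. *)
Lemma unrecovered_first_to_complete (R : realType) (K : nat)
    (A : 'M[R[i]]_K -> 'I_4 -> 'M[R[i]]_K) h t0 n (i0 : 'I_4) :
  injective (A (h t0)) -> A (h t0) i0 = h t0 ->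
  unrecovered (recovered_first_to_complete A h t0) t0 n <->
  exists j : 'I_3, forall s, (t0 < s <= t0 + n)%N ->
    h s \notin [:: complement (h t0); A (h t0) (lift i0 j)].
Proof.
move=> Ainj Ai0; split=> [unrec|[j avoid] t /andP[t0t tn]].
  apply: contrapT => /forallNP none.
  have someone j : exists2 s, (t0 < s <= t0 + n)%N &
      h s = complement (h t0) \/ h s = A (h t0) (lift i0 j).
    have /existsNP[s /not_implyP[sn /negP]] := none j.
    by rewrite negbK !inE => /orP[]/eqP; exists s; auto.
  (* This occurrence shows that the window is nonempty, so its last time [t0 + n] belongs to it. *)
  have [s0 s0n _] := someone ord0.
  apply: (unrec (t0 + n)%N); first by lia.
  have [[s [t0s sn hs]]|nocompl] :=
      pselect (occurred h t0 (t0 + n) (complement (h t0))).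
    by left; exists s.
  right=> i Ai; have [i'|eq_i] := unliftP i0 i; last by rewrite eq_i Ai0 in Ai.
  move=> ->; have [s /andP[t0s sn] [hs|hs]] := someone i'; exists s => //.
  by case: nocompl; exists s.
case=> [[s [t0s st hs]]|others].
  have := avoid s; rewrite hs !inE eqxx => /(_ _)/negP; apply=> //.
  by rewrite t0s (leq_trans st).
have [|s [t0s st hs]] := others (lift i0 j).
  by rewrite -{2}Ai0 => /Ainj /eqP; rewrite eq_sym (negbTE (neq_lift _ _)).
have := avoid s; rewrite hs !inE eqxx orbT => /(_ _)/negP; apply=> //.
by rewrite t0s (leq_trans st).
Qed.

(** * Tail probabilities and average delay of time-sharing *)

Section TimeSharing.
Context (R : realType) (K : nat) (HH : {fset 'M[R[i]]_K}).
Context (A : 'M[R[i]]_K -> 'I_4 -> 'M[R[i]]_K).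
Hypothesis HHc : forall H, H \in HH -> complement H \in HH.
Hypothesis Ainj : forall H, H \in HH -> injective (A H).
Hypothesis AHH : forall H, H \in HH -> forall i, A H i \in HH.
Hypothesis Amem : forall H, H \in HH -> exists i, A H i = H.
Hypothesis Acompl : forall H, H \in HH -> forall i, A H i <> complement H.
Context d (T : measurableType d) (P : probability T R).
Context (X : nat -> T -> 'M[R[i]]_K).
Hypothesis Xiid : iid_uniform P HH X.
Variables (alpha : R) (C : T -> bool).
Hypothesis Ccoin : independent_coin P X alpha C.
Variable t0 : nat.

Local Notation N := (#|` HH|%:R : R).

Definition unrecovered_time_sharing n : set T :=
  [set w | unrecovered (recovered_time_sharing A (C w) (X^~ w) t0) t0 n].

(** The probability, under the scheme selected by [b], of no recovery within [n] steps; it is the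
    same for every start in [HH]. *)
Definition tail_prob (b : bool) (n : nat) : R :=
  if b then 3 * (1 - 2 / N) ^+ n - 3 * (1 - 3 / N) ^+ n + (1 - 4 / N) ^+ n
  else (1 - 1 / N) ^+ n.

(** With coin and start fixed, failure becomes an avoidance event: avoiding [complement H] for
    [false], and a union of three such events for [true]. *)
Lemma start_unrecovered b H n : H \in HH ->
  let E := C @^-1` [set b] `&`
    (X t0 @^-1` [set H] `&` unrecovered_time_sharing n) in
  measurable E /\
  P E = ((if b then alpha else 1 - alpha) * (N^-1 * tail_prob b n))%:E.
Proof.
move=> HHH; pose V s := C @^-1` [set b] `&`
  (X t0 @^-1` [set H] `&` avoids X t0 n s).
have mV s : measurable (V s).
  apply: measurableI; first exact: measurable_coin Ccoin b.
  apply: measurableI; [exact: (measurable_fiber Xiid)|].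
  exact: (measurable_avoids Xiid).
(* The events [V s] are closed under intersection, so every term of inclusion-exclusion is again
   some [P (V s)]. *)
have VI s1 s2 : V s1 `&` V s2 = V (s1 ++ s2).
  by rewrite /V setIACA setIid setIACA setIid avoids_cat.
have eqV s1 s2 : s1 =i s2 -> V s1 = V s2.
  by move=> /eq_avoids eqs; rewrite /V eqs.
have PV := prob_start_avoids Xiid Ccoin b t0 n HHH.
case: b @V mV VI eqV PV => V mV VI eqV PV /=; last first.
  rewrite (_ : C @^-1` _ `&` _ = V [:: complement H]); last first.
    apply/seteqP; split => [w [/= Cw [Xw unrec]]|w [/= Cw [Xw avoid]]].
      do 2 split=> //; move=> t tn; rewrite inE; apply/eqP => Xt.
      apply: (unrec t) => //; rewrite Cw /= /recovered_complement Xt.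
      by rewrite [in RHS]Xw.
    do 2 split=> //; move=> t /avoid.
    by rewrite inE Cw /= /recovered_complement Xw => /eqP.
  split; first exact: mV.
  by rewrite PV // => x; rewrite inE => /eqP ->; exact: HHc.
have [i0 Ai0] := Amem HHH.
pose a j := A H (lift i0 j); pose c := complement H.
have -> : C @^-1` [set true] `&`
    (X t0 @^-1` [set H] `&` unrecovered_time_sharing n) =
    V [:: c; a 0] `|` V [:: c; a 1] `|` V [:: c; a 2%:R].
  have unrecE w : X t0 w = H -> unrecovered
      (recovered_first_to_complete A (X^~ w) t0) t0 n <->
      exists j, avoids X t0 n [:: c; a j] w.
    move=> Xw; have := @unrecovered_first_to_complete _ _ A (X^~ w) t0 n i0.
    by rewrite Xw; apply=> //; exact: Ainj.
  have Vunrec j w : V [:: c; a j] w -> (C @^-1` [set true] `&`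
      (X t0 @^-1` [set H] `&` unrecovered_time_sharing n)) w.
    move=> [/= Cw [Xw avoid]]; do 2 split=> //.
    by rewrite /unrecovered_time_sharing /= Cw; apply/unrecE => //; exists j.
  apply/seteqP; split => [w [/= Cw [Xw]]|w [[]|]]; try exact: Vunrec.
  rewrite /unrecovered_time_sharing /= Cw => /unrecE -/(_ Xw)[j avoid].
  have [jE|jE|jE] : [\/ j = 0, j = 1 | j = 2%:R].
  - by case: j {avoid} => -[|[|[|//]]] lt_j;
      [apply: Or31|apply: Or32|apply: Or33]; apply: val_inj.
  - by left; left; do 2 split=> //; rewrite -jE.
  - by left; right; do 2 split=> //; rewrite -jE.
  - by right; do 2 split=> //; rewrite -jE.
have ca j : c != a j by apply/eqP => /esym; exact: Acompl.
have aE j k : (a j == a k) = (j == k).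
  by rewrite (inj_eq (Ainj HHH)) (inj_eq lift_inj).
have aH j : a j \in HH by exact: AHH.
have cH : c \in HH by exact: HHc.
split; first by do 2 ?apply: measurableU; exact: mV.
have PVu s : uniq s -> all (mem HH) s -> P (V s) =
    (alpha * (N^-1 * (1 - (size s)%:R / N) ^+ n))%:E.
  by move=> us /allP sH; rewrite PV.
have P2 j : P (V [:: c; a j]) = (alpha * (N^-1 * (1 - 2 / N) ^+ n))%:E.
  by rewrite PVu //= ?inE ?ca ?aH ?cH.
have P3 j k : j != k -> P (V [:: c; a j] `&` V [:: c; a k]) =
    (alpha * (N^-1 * (1 - 3 / N) ^+ n))%:E.
  (* The concatenation repeats [c], whereas the probability formula needs a duplicate-free list. *)
  move=> jk; rewrite VI (eqV _ [:: c; a j; a k]); last first.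
    by move=> x; rewrite !inE; do !case: eqP.
  by rewrite PVu //= ?inE ?negb_or ?ca ?aH ?cH ?aE ?jk.
(* The triple intersection, in the shape obtained by distributing the third event over the union of
   the first two. *)
have P4 : P ((V [:: c; a 0] `&` V [:: c; a 2%:R]) `&`
      (V [:: c; a 1] `&` V [:: c; a 2%:R])) =
    (alpha * (N^-1 * (1 - 4 / N) ^+ n))%:E.
  rewrite !VI (eqV _ [:: c; a 0; a 1; a 2%:R]); last first.
    by move=> x; rewrite !inE; do !case: eqP.
  by rewrite PVu //= ?inE ?negb_or ?ca ?aH ?cH ?aE.
have mVI s1 s2 : measurable (V s1 `&` V s2) by exact: measurableI.
(* Two-event inclusion-exclusion is nested: the union of the first two events, then the third. The
   value supplied as [(c := ...)] is the probability that the third event meets that union, itself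
   found by inclusion-exclusion. *)
rewrite (prob_setU _ _ (prob_setU _ _ (P2 0) (P2 1) (P3 _ _ _)) (P2 2%:R)
  (c := alpha * (N^-1 * (1 - 3 / N) ^+ n)
      + alpha * (N^-1 * (1 - 3 / N) ^+ n)
      - alpha * (N^-1 * (1 - 4 / N) ^+ n))) //.
- by congr (_%:E); ring.
- exact: measurableU.
by rewrite setIUl; apply: prob_setU => //; exact: P3.
Qed.

(** Total probability over the coin and the start: the [N] starts contribute equally, which cancels
    the factor [N^-1]. *)
Lemma prob_unrecovered n :
  measurable (unrecovered_time_sharing n) /\
  P (unrecovered_time_sharing n) =
  (alpha * tail_prob true n + (1 - alpha) * tail_prob false n)%:E.
Proof.
set E := unrecovered_time_sharing n; have [XH _ _ _] := Xiid.
have N0 : N != 0.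
  have [H HHH] := support_nonempty Xiid.
  by rewrite pnatr_eq0 -lt0n cardfs_gt0; apply/fset0Pn; exists H.
pose F b H := C @^-1` [set b] `&` (X t0 @^-1` [set H] `&` E).
have mF b H : H \in HH -> measurable (F b H).
  by move=> HHH; have [] := start_unrecovered b n HHH.
have EbE b : C @^-1` [set b] `&` E = \bigcup_(H in [set` HH]) F b H.
  apply/seteqP; split => [w [Cw Ew]|w [H _ [Cw [_ Ew]]]]; last by split.
  by exists (X t0 w); [exact: XH|do 2 split => //].
have mEb b : measurable (C @^-1` [set b] `&` E).
  rewrite EbE; apply: fin_bigcup_measurable => // H; exact: mF.
have PEb b : P (C @^-1` [set b] `&` E) =
    ((if b then alpha else 1 - alpha) * tail_prob b n)%:E.
  (* The draw at [t0] always lies in [HH], so this intersection changes nothing and lets the event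
     be split by start. *)
  rewrite (_ : _ `&` E =
      (C @^-1` [set b] `&` E) `&` X t0 @^-1` [set` enum_fset HH]); last first.
    by apply/seteqP; split => [w CE|w []//]; split => //; exact: XH.
  rewrite (total_probability Xiid) ?fset_uniq //.
  rewrite (eq_big_seq (fun=> ((if b then alpha else 1 - alpha) *
      (N^-1 * tail_prob b n))%:E)) => [|H HHH]; last first.
    by rewrite setIAC -setIA; have [] := start_unrecovered b n HHH.
  rewrite sumEFin big_const_seq count_predT iter_addr addr0.
  by congr (_%:E); rewrite -[LHS]mulr_natl; field.
have EE : E = (C @^-1` [set true] `&` E) `|` (C @^-1` [set false] `&` E).
  apply/seteqP; split => [w Ew|w [[_ Ew]|[_ Ew]]] //.
  by case Cw: (C w); [left|right].
split; first by rewrite EE; exact: measurableU.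
(* The two coin outcomes are disjoint, hence intersection probability 0. *)
rewrite EE (prob_setU _ _ (PEb true) (PEb false) (c := 0)) ?subr0 //.
by rewrite [X in P X](_ : _ = set0) ?measure0 //; apply/seteqP; split => // w
  [[/= -> _] []].
Qed.

(** [complement H] and the four members of [A H] are five distinct realizations. Hence [k / N < 1]
    for [k] up to 4, which makes the geometric series converge. *)
Lemma card_support_ge5 : (5 <= #|` HH|)%N.
Proof.
have [H HHH] := support_nonempty Xiid.
pose s := complement H :: [seq A H i | i <- enum 'I_4].
have -> : 5%N = size s by rewrite /= size_map size_enum_ord.
apply: uniq_leq_size => [|M].
  rewrite /= (map_inj_uniq (Ainj HHH)) enum_uniq andbT.
  by apply/negP => /mapP[i _ /esym]; exact: Acompl.
rewrite inE => /predU1P[->|/mapP[i _ ->]]; first exact: HHc.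
exact: AHH.
Qed.

(** Grouped by ratio, the tail probabilities are four geometric sequences, with total [(1 - alpha) *
    N + alpha * (3 * N / 2 - N + N / 4)]. *)
Lemma average_delay_time_sharing :
  average_delay P (fun w => time_sharing_delay A (C w) (X^~ w) t0) =
  ((1 - alpha / 4) * N)%:E.
Proof.
rewrite (_ : (fun w => _) =
    fun w => delay R (recovered_time_sharing A (C w) (X^~ w) t0) t0).
  rewrite average_delay_tail_sum => [|n]; last by have [] := prob_unrecovered n.
  have N5 : 5%:R <= N by rewrite ler_nat card_support_ge5.
  have N_gt0 : 0 < N by lra.
  have ratio_lt1 (k : nat) : (0 < k < 5)%N -> `|1 - k%:R / N| < 1.
    move=> /andP[k0 k5]; have kN : k%:R / N < 1.
      by rewrite ltr_pdivrMr // mul1r (lt_le_trans _ N5) // ltr_nat.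
    have : 0 < k%:R / N by rewrite divr_gt0 // ltr0n.
    by rewrite ltr_norml; lra.
  have mixE n : alpha * tail_prob true n + (1 - alpha) * tail_prob false n =
      (1 - alpha) * (1 - 1 / N) ^+ n + (alpha * 3) * (1 - 2 / N) ^+ n +
      - (alpha * 3) * (1 - 3 / N) ^+ n + alpha * (1 - 4 / N) ^+ n.
    by rewrite /tail_prob; ring.
  under eq_eseriesr do rewrite (prob_unrecovered _).2 mixE.
  rewrite geometric_nneseries; first last.
  - exact: (ratio_lt1 4%N).
  - exact: (ratio_lt1 3%N).
  - exact: (ratio_lt1 2%N).
  - exact: (ratio_lt1 1%N).
  congr (_%:E); have subE (k : R) : 1 - (1 - k / N) = k / N by ring.
  by rewrite !subE; field; lra.
by apply/funext => w; rewrite /time_sharing_delay /recovered_time_sharing;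
  case: (C w).
Qed.

End TimeSharing.

(** * The pure schemes and the final formula *)

(** The events of a deterministic coin are empty or the whole space, hence independent of
    everything. Each pure scheme thereby becomes an instance of time-sharing. *)
Lemma constant_coin d (T : measurableType d) (R : realType)
    (P : probability T R) (S : Type) (X : nat -> T -> S) (c : bool) :
  independent_coin P X (c%:R) (fun=> c).
Proof.
have preimE b : (fun=> c) @^-1` [set b] = if c == b then [set: T] else set0.
  by case: eqP => cb; apply/seteqP; split.
split; rewrite ?preimE.
- by case: eqP.
- by case: c {preimE}; rewrite ?probability_setT ?measure0.
move=> b J B; rewrite preimE; case: eqP => _.
  by rewrite setTI [in RHS]probability_setT mul1e.
by rewrite set0I measure0 mul0e.
Qed.

Theorem theorem6 (R : realType) (K : nat) (HH : {fset 'M[R[i]]_K})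
  (A : 'M[R[i]]_K -> 'I_4 -> 'M[R[i]]_K)
  (HHc : forall H, H \in HH -> complement H \in HH)
  (Aalign : forall H, H \in HH -> alignment_set (A H))
  (Ainj : forall H, H \in HH -> injective (A H))
  (AHH : forall H, H \in HH -> forall i, A H i \in HH)
  (Amem : forall H, H \in HH -> exists i, A H i = H)
  (Acompl : forall H, H \in HH -> forall i, A H i <> complement H)
  (d : measure_display) (T : measurableType d) (P : probability T R)
  (X : nat -> T -> 'M[R[i]]_K) (Xiid : iid_uniform P HH X)
  (alpha : R) (alpha0 : 0 <= alpha) (alpha1 : alpha <= 1)
  (C : T -> bool) (Ccoin : independent_coin P X alpha C)
  (t0 : nat) :
  let h w := fun t => X t w in
  let d_2 := average_delay P (fun w => complement_delay (h w) t0) in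
  let d_24 := average_delay P (fun w => first_to_complete_delay A (h w) t0) in
  let d_alpha :=
    average_delay P (fun w => time_sharing_delay A (C w) (h w) t0) in
  d_alpha = ((1 - alpha)%:E * d_2 + alpha%:E * d_24)%E /\
  d_alpha = ((1 - alpha / 4) * #|` HH|%:R)%:E.
Proof.
move=> h d_2 d_24 d_alpha.
have delayE := average_delay_time_sharing HHc Ainj AHH Amem Acompl Xiid.
(* The two schemes are the time-sharing schemes with constant coins. *)
have -> : d_2 = (#|` HH|%:R)%:E.
  by have := delayE _ _ (constant_coin P X false) t0; rewrite mul0r subr0 mul1r.
have -> : d_24 = ((1 - 1 / 4) * #|` HH|%:R)%:E.
  exact: (delayE _ _ (constant_coin P X true) t0).
have -> : d_alpha = ((1 - alpha / 4) * #|` HH|%:R)%:E by exact: delayE.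
by split=> //; rewrite -!EFinM -EFinD; congr (_%:E); field.
Qed.
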